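(* Let $F$ be a field and let $R$ be an algebraic $F$-algebra. Then, in each of the following cases, $R$ is a periodic ring: (1) there is a natural number $k$ such that each element of $F$ (viewed as an element of $R$) is a sum of $k$ pairwise commuting periodic elements of $R$; (2) $R$ is additively $2$-periodic; (3) the unit group $\mathcal{U}(R)$ is a torsion group.
   Context: All rings and algebras are associative with identity; natural numbers are positive integers. An $F$-algebra is algebraic if each of its elements is a root of a nonzero polynomial over $F$. $F$ is identified with its image $F\cdot 1_R$ in $R$. An element $r$ of a ring $R$ is periodic if $r^n=r^m$ for some natural numbers $n>m\ge 1$; $R$ is a periodic ring if all its elements are periodic. $R$ is additively $2$-periodic if each of its elements is a sum of at most $2$ periodic elements of $R$. $\mathcal{U}(R)$ denotes the multiplicative group of units of $R$. *)

(* Defs.v *)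
From mathcomp Require Import all_boot all_order all_algebra.

Set Implicit Arguments.
Unset Strict Implicit.
Unset Printing Implicit Defensive.

Import GRing.Theory.
Local Open Scope ring_scope.

Definition periodic (R : nzRingType) (r : R) : Prop :=
  exists m n : nat, (1 <= m < n)%N /\ r ^+ n = r ^+ m.

Definition periodic_ring (R : nzRingType) : Prop :=
  forall r : R, periodic r.

Definition sum_of_periodic (R : nzRingType) (k : nat) (r : R) : Prop :=
  exists p : 'I_k -> R, (forall i, periodic (p i)) /\ r = \sum_(i < k) p i.

Definition sum_of_commuting_periodic (R : nzRingType) (k : nat) (r : R) :
    Prop :=
  exists p : 'I_k -> R,
    [/\ forall i, periodic (p i),
        forall i j, GRing.comm (p i) (p j)
      & r = \sum_(i < k) p i].

Definition additively_periodic (n : nat) (R : nzRingType) : Prop :=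
  forall r : R, exists k : nat, (1 <= k <= n)%N /\ sum_of_periodic k r.

(* Stated in Prop so that it applies to every ring: [GRing.unit] is only
   available on a [unitRingType], where units are decidable. *)
Definition invertible (R : nzRingType) (u : R) : Prop :=
  exists v : R, v * u = 1 /\ u * v = 1.

Definition torsion_units (R : nzRingType) : Prop :=
  forall u : R, invertible u -> exists n : nat, (0 < n)%N /\ u ^+ n = 1.

(* [algebraicOver] of mxpoly requires the extension to be a field; this is the
   same condition for a possibly noncommutative algebra. *)
Definition algebraic_algebra (F : fieldType) (R : algType F) : Prop :=
  forall r : R, exists2 p : {poly F}, p != 0 & root (map_poly (in_alg R) p) r.

(* Main.v *)
(* Each hypothesis makes every element of F integral over the integers. In (3)
   a nonzero scalar is a root of some X^n - 1. In (1) a scalar is a sum of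
   commuting roots of polynomials X^n - X^m; by (2) it is a sum p + q of
   periodic elements, and centrality of p + q makes p and q commute.
   Integrality of 1/2 forces F to have positive characteristic p, and by
   transitivity every r in R is integral over the integers. Hence the powers
   of r are combinations, with coefficients modulo p, of finitely many of them:
   they form a finite set, so two of them coincide. *)
Require Import Defs.
From mathcomp Require Import all_boot all_order all_algebra.
From mathcomp Require Import boolp.
From HB Require Import structures.

Set Implicit Arguments.
Unset Strict Implicit.
Unset Printing Implicit Defensive.

Import GRing.Theory.
Local Open Scope ring_scope.

(* The bicommutant of pairwise commuting elements is a commutative subalgebra
   containing them, so that the theory of integral elements of commutative rings
   applies inside the noncommutative algebra R. *)
Section Bicommutant.

Variables (F : fieldType) (R : algType F) (P : R -> Prop).

Definition bicommutant : {pred R} :=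
  fun r => `[< forall c, (forall x, P x -> GRing.comm c x) -> GRing.comm c r >].

Lemma bicommutantP r :
  reflect (forall c, (forall x, P x -> GRing.comm c x) -> GRing.comm c r)
          (r \in bicommutant).
Proof. exact: asboolP. Qed.

Lemma mem_bicommutant x : P x -> x \in bicommutant.
Proof. by move=> Px; apply/bicommutantP => c; apply. Qed.

Lemma bicommutant_subalg : GRing.subsemialg_closed bicommutant.
Proof.
split.
- by apply/bicommutantP => c _; apply: commr1.
- split; first by apply/bicommutantP => c _; apply: commr0.
    move=> u v /bicommutantP cu /bicommutantP cv; apply/bicommutantP => c Pc.
    by apply: commrD; [apply: cu | apply: cv].
  move=> a u /bicommutantP cu; apply/bicommutantP => c Pc.
  by rewrite /GRing.comm -scalerAl -scalerAr cu.
- move=> u v /bicommutantP cu /bicommutantP cv; apply/bicommutantP => c Pc.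
  by apply: commrM; [apply: cu | apply: cv].
Qed.

HB.instance Definition _ :=
  GRing.isSubalgClosed.Build F R bicommutant bicommutant_subalg.

Hypothesis Pcomm : forall x y, P x -> P y -> GRing.comm x y.

(** Since the elements of [P] commute, [P] lies in its own commutant. Hence the bicommutant does
    too, and its elements commute with one another. *)
Lemma bicommutant_comm r s :
  r \in bicommutant -> s \in bicommutant -> GRing.comm r s.
Proof.
move=> /bicommutantP rP /bicommutantP sP; apply: sP => x Px.
by apply/commr_sym/rP => y Py; apply: Pcomm.
Qed.

(** The type carries the commutation proof so that inference can recover it for the commutative ring
    instance below. *)
Definition bicommutant_type & (forall x y, P x -> P y -> GRing.comm x y) :=
  {r : R | r \in bicommutant}.
Local Notation K := (bicommutant_type Pcomm).

HB.instance Definition _ := SubChoice.copy K {r : R | r \in bicommutant}.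
HB.instance Definition _ := [SubChoice_isSubAlgebra of K by <:].

Lemma bicommutant_mulC : commutative (@GRing.mul K).
Proof. by move=> u v; apply/val_inj/bicommutant_comm; apply: valP. Qed.

HB.instance Definition _ :=
  GRing.PzRing_hasCommutativeMul.Build K bicommutant_mulC.

End Bicommutant.

Lemma periodic_integral (R : nzRingType) (x : R) :
  periodic x -> integralOver intr x.
Proof.
move=> [m [n [/andP[_ ltmn] xnm]]]; exists ('X^n - 'X^m).
  by rewrite monicE lead_coefDl ?lead_coefXn // size_polyN !size_polyXn.
by rewrite rmorphB /= !map_polyXn /root hornerD hornerN !hornerXn xnm subrr.
Qed.

Lemma map_poly_rmorph_int (R S : nzRingType) (f : {rmorphism R -> S}) g :
  map_poly f (map_poly intr g) = map_poly intr g.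
Proof. by rewrite -map_poly_comp; apply/eq_map_poly/rmorph_int. Qed.

Lemma integral_int_rmorph (R S : nzRingType) (f : {rmorphism R -> S}) x :
  integralOver intr x -> integralOver intr (f x).
Proof.
move=> [g g_monic gx0]; exists g => //.
by rewrite -(map_poly_rmorph_int f) rmorph_root.
Qed.

(** In the bicommutant of the summands, a commutative ring, integral elements are closed under
    addition; the inclusion [val] brings the result back to [R]. *)
Lemma sum_commuting_periodic_integral (F : fieldType) (R : algType F) k
    (r : R) :
  sum_of_commuting_periodic k r -> integralOver intr r.
Proof.
move=> [p [p_per p_comm ->]]; pose P x := exists i, x = p i.
have Pcomm x y : P x -> P y -> GRing.comm x y by move=> [i ->] [j ->].
have Pp i : p i \in bicommutant P by apply: mem_bicommutant; exists i.
pose u i : bicommutant_type Pcomm := Sub (p i) (Pp i).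
have -> : \sum_(i < k) p i = val (\sum_(i < k) u i).
  by rewrite raddf_sum; apply: eq_bigr.
apply: (integral_int_rmorph val); apply: (big_ind (integralOver intr)).
- exact: integral0.
- by move=> x y; apply: integral_add.
move=> i _; apply: periodic_integral; have [m [n [lt_mn pmn]]] := p_per i.
by exists m, n; split=> //; apply: val_inj; rewrite !rmorphXn.
Qed.

(** Transitivity of integrality is applied in the bicommutant of [r] alone, where [q] becomes a
    monic polynomial with integral coefficients. *)
Lemma integral_alg_trans (F : fieldType) (R : algType F) (r : R) :
    (forall a : F, integralOver intr a) -> integralOver (in_alg R) r ->
  integralOver intr r.
Proof.
move=> intF [q q_monic qr0]; pose P x := x = r.
have Pcomm x y : P x -> P y -> GRing.comm x y by move=> -> ->.
have Pr : r \in bicommutant P by apply: mem_bicommutant.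
pose u : bicommutant_type Pcomm := Sub r Pr.
have -> : r = val u by [].
apply: (integral_int_rmorph val).
apply: (@integral_root_monic _ _ _ _ (map_poly (in_alg _) q)).
- by rewrite monic_map.
- apply/eqP/val_inj; rewrite -horner_map -map_poly_comp rmorph0 /=.
  by rewrite (eq_map_poly (g := in_alg R)) //; apply/eqP.
by apply/integral_poly => i; rewrite coef_map; apply: integral_int_rmorph.
Qed.

Lemma integral_pchar_periodic (R : nzRingType) p (r : R) :
  p \in [pchar R] -> integralOver intr r -> periodic r.
Proof.
move=> pcharRp [g g_monic gr0].
have pr_p : prime p by case/andP: pcharRp.
set e := size g; pose rem i := Pdiv.Ring.rmodp 'X^i g.
(* Divide [X^i] by the monic [g] over the integers: the quotient term vanishes at [r]. *)
have rE i : r ^+ i = \sum_(k < e) ((rem i)`_k)%:~R * r ^+ k.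
  have comm_r (h : {poly int}) : comm_poly (map_poly intr h) r.
    by apply: comm_coef_poly => k; rewrite coef_map; apply/commr_sym/commr_int.
  have /(congr1 (fun h => (map_poly intr h).[r])) :=
    Pdiv.RingMonic.rdivp_eq g_monic 'X^i.
  rewrite /= map_polyXn hornerXn rmorphD rmorphM /= hornerD hornerM_comm //.
  rewrite (eqP gr0) mulr0 add0r => ->; rewrite (@horner_coef_wide _ e).
    by apply: eq_bigr => k _; rewrite coef_map.
  apply: leq_trans (size_poly _ _) (ltnW _).
  by rewrite Pdiv.Ring.ltn_rmodp monic_neq0.
pose f (i : nat) : {ffun 'I_e -> 'F_p} := [ffun k : 'I_e => ((rem i)`_k)%:~R].
have f_inj i j : f i = f j -> r ^+ i = r ^+ j.
  move=> /ffunP fij; rewrite !rE; apply: eq_bigr => k _; congr (_ * _).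
  (* An integer vanishes in [R] exactly when [p] divides it, hence exactly when it vanishes in the
     prime field. *)
  apply/eqP; rewrite -subr_eq0 -rmorphB -(dvdz_pcharf pcharRp).
  rewrite (dvdz_pcharf (pchar_Fp pr_p)) rmorphB subr_eq0.
  by apply/eqP; have := fij k; rewrite !ffunE.
(* Pigeonhole; the shift to [i.+1] keeps both exponents positive. *)
have /injectivePn[i [j neq_ij fij]] :
    ~~ injectiveb (fun i : 'I_(#|{ffun 'I_e -> 'F_p}|.+1) => f i.+1).
  by apply/injectiveP => /leq_card; rewrite card_ord ltnn.
have := neq_ij; rewrite -val_eqE neq_ltn => /orP[] lt_ij.
  by exists i.+1, j.+1; split; [|exact/f_inj/esym].
by exists j.+1, i.+1; split; [|exact/f_inj].
Qed.

Lemma pchar_of_integral_half (F : fieldType) :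
  integralOver intr (2^-1 : F) -> exists p, p \in [pchar F].
Proof.
have [two0 _ | two_neq0] := eqVneq (2 : F) 0.
  by apply: (@natf0_pchar _ 2); rewrite ?two0.
move=> [g g_monic]; set n := (size g).-1.
have sz_g : size g = n.+1 by rewrite prednK // size_poly_gt0 monic_neq0.
rewrite /root (@horner_coef_wide _ n.+1) -?sz_g ?size_poly // sz_g.
rewrite big_ord_recr /= coef_map [g`_n](monicP g_monic) mul1r => /eqP half0.
(* Multiplying the integral equation of 1/2 by 2^n shows that an odd integer
   vanishes in F. *)
pose z : int := \sum_(i < n) g`_i * 2 ^+ (n.-1 - i).
have oddz0 : (1 + 2 * z)%:~R = 0 :> F.
  have := congr1 ( *%R (2 ^+ n)) half0; rewrite mulr0 mulrDr => <-.
  rewrite -exprMn divff // expr1n addrC rmorphD rmorphM rmorph_sum /=.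
  congr (_ + _); rewrite !mulr_sumr; apply: eq_bigr => i _.
  rewrite coef_map rmorphM rmorphXn /= !mulrA [2 * _]mulrC [2 ^+ n * _]mulrC.
  rewrite -!mulrA -exprS; congr (_ * _).
  have lt_in := ltn_ord i.
  (* Split [2^n] as [2^(n-i) * 2^i]; the second factor cancels the [i]-th power of 1/2. *)
  rewrite -[X in _ = 2 ^+ X * _](subnK (ltnW lt_in)) exprD.
  rewrite -mulrA -exprMn divff // expr1n mulr1; congr (_ ^+ _).
  by rewrite -subSn -1?ltnS (ltn_predK lt_in).
have: 1 + 2 * z != 0.
  by apply/eqP => /(congr1 (fun x => x %% 2)%Z); rewrite addrC mulrC modzMDl.
(* Up to sign, this is a positive natural number vanishing in [F], so one of its prime factors is
   the characteristic. *)
case: (1 + 2 * z) oddz0 => m /eqP m0 nz.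
  by apply: (@natf0_pchar _ m) => //; rewrite lt0n.
by apply: (@natf0_pchar _ m.+1); rewrite // NegzE rmorphN oppr_eq0 in m0 *.
Qed.

Lemma integral_field_periodic_ring (F : fieldType) (R : algType F) :
    algebraic_algebra R -> (forall a : F, integralOver intr (a%:A : R)) ->
  periodic_ring R.
Proof.
move=> algR intA.
(* The map from [F] to [R] is injective, so integral equations of scalars descend to [F]. *)
have intF (a : F) : integralOver intr a.
  have [g g_monic ga0] := intA a; exists g => //.
  move: ga0; rewrite -(map_poly_rmorph_int (in_alg R)).
  by rewrite /root (horner_map (in_alg R)) fmorph_eq0.
have [p pcharFp] := pchar_of_integral_half (intF _).
move=> r; apply: (@integral_pchar_periodic _ p).
  by rewrite (rmorph_pchar (in_alg R)).
apply: integral_alg_trans => //.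
have [q q_neq0 qr0] := algR r; exists ((lead_coef q)^-1 *: q).
  by rewrite monicE lead_coefZ mulVf ?lead_coef_eq0.
by rewrite map_polyZ /root hornerZ (eqP qr0) mulr0.
Qed.

Lemma additively_2_periodic_central (R : nzRingType) (z : R) :
    additively_periodic 2 R -> (forall x, GRing.comm z x) ->
  sum_of_commuting_periodic 2 z.
Proof.
move=> per2 z_comm.
have [p [q [p_per q_per zE]]] :
    exists p q, [/\ periodic p, periodic q & z = p + q].
  have [[|[|[|k]]] [// _ [p [p_per ->]]]] := per2 z.
    (* A single summand is padded with the periodic element 0. *)
    exists (p ord0), 0; rewrite big_ord1 addr0; split=> //.
    by exists 1%N, 2%N; rewrite !expr0n.
  exists (p ord0), (p (lift ord0 ord0)).
  by rewrite !big_ord_recl big_ord0 addr0.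
(* Cancel [q * q] in [(p + q) * q = q * (p + q)]. *)
have pq_comm : GRing.comm p q.
  by move: (z_comm q); rewrite zE /GRing.comm mulrDl mulrDr => /addIr.
exists (fun i => if i == ord0 then p else q); split.
- by move=> i; case: ifP.
- by move=> i j; do 2!case: ifP => _ //; apply: commr_sym.
- by rewrite zE !big_ord_recl big_ord0 addr0.
Qed.

Theorem theorem2p7 (F : fieldType) (R : algType F)
    (algR : algebraic_algebra R) :
  [/\ (exists k : nat, (0 < k)%N /\
         forall a : F, sum_of_commuting_periodic k (a%:A : R)) ->
        periodic_ring R,
      additively_periodic 2 R -> periodic_ring R
    & torsion_units R -> periodic_ring R].
Proof.
split.
- move=> [k [_ sumF]]; apply: integral_field_periodic_ring => // a.
  exact: sum_commuting_periodic_integral (sumF a).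
- move=> per2; apply: integral_field_periodic_ring => // a.
  apply: sum_commuting_periodic_integral (additively_2_periodic_central per2 _).
  by move=> x; rewrite /GRing.comm -scalerAl -scalerAr mul1r mulr1.
- move=> tors; apply: integral_field_periodic_ring => // a.
  have [-> | a_neq0] := eqVneq a 0; first by rewrite scale0r; apply: integral0.
  have [|n [n_gt0 an1]] := tors a%:A.
    by exists a^-1%:A; rewrite -!scalerAl !mul1r !scalerA mulVf ?mulfV ?scale1r.
  (* From [a^n = 1] follows [a^(2n) = a^n], with both exponents positive. *)
  apply: periodic_integral; exists n, n.*2.
  by rewrite -addnn exprD an1 mulr1 n_gt0 -[n.+1]addn1 leq_add2l.
Qed.
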